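(* For $n\ge 2$ and $1\le r<n$ a positive integer, the group $\mathcal O_{n,r}$ (the outer automorphism group $\operatorname{Out}(G_{n,r})$ of the Higman--Thompson group $G_{n,r}$, realized as a group of core transducers) is infinite, and so the group $\mathcal O_n=\bigcup_{1\le r<n}\mathcal O_{n,r}$ is infinite.
   Context: Spaces. $X_n=\{0,\dots,n-1\}$; $\dot{\mathbf r}$ is a set of $r$ symbols disjoint from $X_n$ (''dotted letters''); $\mathfrak C_n=X_n^\omega$ and $\mathfrak C_{n,r}=\{ca_1a_2\ldots: c\in\dot{\mathbf r},a_i\in X_n\}$ with product topologies; $\varepsilon$ is the empty word; $W_{n,r,\varepsilon}$ is the set of finite words $ca_1\ldots a_k$, $k\ge0$, $c\in\dot{\mathbf r}$, $a_i\in X_n$; $U_\eta$ is the set of infinite sequences with prefix $\eta$. $G_{n,r}$ is the group of homeomorphisms $g$ of $\mathfrak C_{n,r}$ for which there are complete antichains (finite maximal sets of pairwise prefix-incomparable words of $W_{n,r,\varepsilon}$) $\{\eta_i\}_{i<k}$, $\{\zeta_i\}_{i<k}$ with $(\eta_ix)g=\zeta_ix$ for all $i$, $x\in\mathfrak C_n$. Transducers for $\mathfrak C_{n,r}$. $A_{q_0}=(\dot{\mathbf r},X_n,R,S,\pi,\lambda,q_0)$ with state set $Q=R\sqcup S$ ($R$ finite, $S$ at most countable), $q_0\in R$, and $\pi(x,q)\in Q\setminus\{q_0\}$, $\lambda(x,q)$ a finite word, defined for $x\in\dot{\mathbf r}$ if $q=q_0$ and for $x\in X_n$ if $q\neq q_0$,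 such that: (1) $\pi(x,q)\in R$ implies $q\in R$, $\lambda(x,q)=\varepsilon$; (2) $q\in R$, $\pi(x,q)\in S$ implies $\lambda(x,q)\in W_{n,r,\varepsilon}$; (3) $q\in S$ implies $\pi(x,q)\in S$, $\lambda(x,q)\in X_n^*$; and with the extensions $\pi(\mu\nu,q)=\pi(\nu,\pi(\mu,q))$, $\lambda(\mu\nu,q)=\lambda(\mu,q)\lambda(\nu,\pi(\mu,q))$ (also to infinite inputs), (4) $\pi(w,q)=q$ with $w$ nonempty implies $\lambda(w,q)\neq\varepsilon$; (5) for $q\in S$ and $x\in \mathfrak C_n$, $\lambda(x,q)\in\mathfrak C_n$. Each state $q$ induces a map $h_q:x\mapsto\lambda(x,q)$, and $A_{q_0}$ represents $h_{q_0}:\mathfrak C_{n,r}\to\mathfrak C_{n,r}$. It is minimal if every state is $\pi(\nu,q_0)$ for some $\nu$, if for every nonempty valid input word $\nu$ the word $\lambda(\nu,q_0)$ is the longest common prefix of $U_\nu h_{q_0}$, and if distinct states in $Q\setminus\{q_0\}$ induce distinct maps. Each homeomorphism $h$ representable by a finite transducer has a minimal one $A_h$, unique up to isomorphism. A transducer over $X_n$ (without initial state) is $T=\langle X_n,Q,\pi,\lambda\rangle$ with $\pi:X_n\times Q\to Q$, $\lambda:X_n\times Q\to X_n^*$, such that infinite inputs yield infinite outputs; $h_q:\mathfrak C_n\to\mathfrak C_n$ is the map induced by the state $q$. Transducers over $X_n$ are identified when strongly isomorphic (a bijection of states commuting with $\pi$ and $\lambda$). Synchronization and core. A transducer is strongly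 synchronizing if for some $m$, for every valid input word $w$ of length $m$, $\pi(w,q)$ takes the same value $\mathfrak s(w)$ for all states $q$ from which $w$ can be read (words with a dotted first letter are read only from $q_0$, words over $X_n$ from every state other than $q_0$). Its core, $\operatorname{Core}(A)$, is the transducer over $X_n$ obtained by restricting $\pi,\lambda$ to the set of states $\{\mathfrak s(w): w\in X_n^m\}$ (this does not depend on $m$). $\mathcal B_{n,r}$ is the group of homeomorphisms $h$ of $\mathfrak C_{n,r}$ such that $h$ and $h^{-1}$ are both representable by finite strongly synchronizing transducers. $\mathcal O_{n,r}=\{\operatorname{Core}(A_g): g\in\mathcal B_{n,r}\}$. Every automorphism of $G_{n,r}$ is conjugation by a unique $g\in\mathcal B_{n,r}$, and $\operatorname{Out}(G_{n,r})$ is identified with $\mathcal O_{n,r}$ by sending the class of this automorphism to $\operatorname{Core}(A_g)$. Product $T_1T_2$ (the group operation on $\mathcal O_{n,r}$ and on $\mathcal O_n$). (a) Form the full product $T_1*T_2$ with states $Q_{T_1}\times Q_{T_2}$, $\pi(x,(p,q))=(\pi_{1}(x,p),\pi_{2}(\lambda_{1}(x,p),q))$, $\lambda(x,(p,q))=\lambda_{2}(\lambda_{1}(x,p),q)$. (b) Remove incomplete response: writing $e_s$ for the longest common prefix of the image of $h_s$, replace each output $\lambda(x,s)$ by the word obtained from $\lambda(x,s)e_{\pi(x,s)}$ by deleting its prefix $e_s$. (c) Pass to the core. (d) Identify states inducing equal maps on $\mathfrak C_n$. *)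

(* Defs.v *)
From HB Require Import structures.
From mathcomp Require Import all_boot all_classical.
From mathcomp Require Import topology.

Set Implicit Arguments.
Unset Strict Implicit.
Unset Printing Implicit Defensive.

Local Open Scope classical_set_scope.

(* Infinite sequences over Y are functions nat -> Y. *)
Definition seq_prefix (Y : Type) (w : seq Y) (y : nat -> Y) : Prop :=
  w = mkseq y (size w).

Definition is_lcp (Y : eqType) (w : seq Y) (B : set (nat -> Y)) : Prop :=
  (forall y, B y -> seq_prefix w y) /\
  (forall v : seq Y, (forall y, B y -> seq_prefix v y) -> prefix v w).

Section Machine.
Variables X Y Q : Type.
Variables (pi : X -> Q -> Q) (lam : X -> Q -> seq Y).

Fixpoint pi_word (w : seq X) (q : Q) : Q :=
  if w is x :: v then pi_word v (pi x q) else q.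

Fixpoint lam_word (w : seq X) (q : Q) : seq Y :=
  if w is x :: v then lam x q ++ lam_word v (pi x q) else [::].

(* lambda(x, q) is infinite and equal to y: the outputs on the finite prefixes
   of x are prefixes of y of unbounded length. *)
Definition lam_omega (x : nat -> X) (q : Q) (y : nat -> Y) : Prop :=
  (forall k, seq_prefix (lam_word (mkseq x k) q) y) /\
  (forall N, exists k, (N <= size (lam_word (mkseq x k) q))%N).

End Machine.

Definition Cn (n : nat) := prod_topology (fun _ : nat => discrete_topology 'I_n).

Definition Cnr (n r : nat) := (discrete_topology 'I_r * Cn n)%type.

(* Dotted letters are the [inl c], letters of X_n the [inr a]. *)
Definition letter (n r : nat) := ('I_r + 'I_n)%type.

Definition undotted (n r : nat) (x : nat -> 'I_n) : nat -> letter n r :=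
  fun i => inr (x i).

Definition Cnr_seq (n r : nat) (x : Cnr n r) : nat -> letter n r :=
  fun i => if i is j.+1 then inr (x.2 j) else inl x.1.

Definition is_Xn_word (n r : nat) (w : seq (letter n r)) : Prop :=
  exists v : seq 'I_n, w = map inr v.

Definition is_Wnr_word (n r : nat) (w : seq (letter n r)) : Prop :=
  exists (c : 'I_r) (v : seq 'I_n), w = inl c :: map inr v.

Definition cone (n r : nat) (eta : seq (letter n r)) : set (Cnr n r) :=
  [set x | seq_prefix eta (Cnr_seq x)].

(* The functions of a transducer are total in Rocq; their values matter only
   where the letter can be read: dotted letters from the initial state, letters
   of X_n from the other states. *)
Definition reads (n r : nat) (Q : Type) (q0 : Q) (x : letter n r) (q : Q) : Prop :=
  if x is inl _ then q = q0 else q <> q0.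

Fixpoint reads_word (n r : nat) (Q : Type) (q0 : Q)
    (pi : letter n r -> Q -> Q) (w : seq (letter n r)) (q : Q) : Prop :=
  if w is x :: v then reads q0 x q /\ reads_word q0 pi v (pi x q) else True.

(* [itR] is the set R, and its complement is S. *)
Record itransducer (n r : nat) := ITransducer {
  itstate :> Type;
  it0 : itstate;
  itR : set itstate;
  itpi : letter n r -> itstate -> itstate;
  itlam : letter n r -> itstate -> seq (letter n r);
  itR_finite : finite_set itR;
  itS_countable : countable (~` itR);
  it0_R : itR it0;
  itpi_not0 : forall x q, reads it0 x q -> itpi x q <> it0;
  it_toR : forall x q, reads it0 x q -> itR (itpi x q) ->
    itR q /\ itlam x q = [::];
  it_RtoS : forall x q, reads it0 x q -> itR q -> ~ itR (itpi x q) ->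
    is_Wnr_word (itlam x q);
  it_S : forall x q, reads it0 x q -> ~ itR q ->
    ~ itR (itpi x q) /\ is_Xn_word (itlam x q);
  it_cycle : forall w q, reads_word it0 itpi w q -> w <> [::] ->
    pi_word itpi w q = q -> lam_word itpi itlam w q <> [::];
  it_infinite : forall q (x : nat -> 'I_n), ~ itR q ->
    exists y : nat -> 'I_n,
      lam_omega itpi itlam (undotted r x) q (undotted r y)
}.

Definition it_reads (n r : nat) (A : itransducer n r)
    (w : seq (letter n r)) (q : A) : Prop :=
  reads_word (it0 A) (@itpi n r A) w q.

Definition it_pi_word (n r : nat) (A : itransducer n r)
    (w : seq (letter n r)) (q : A) : A :=
  pi_word (@itpi n r A) w q.

Definition it_lam_word (n r : nat) (A : itransducer n r)
    (w : seq (letter n r)) (q : A) : seq (letter n r) :=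
  lam_word (@itpi n r A) (@itlam n r A) w q.

(* The map h_q, as a functional relation on sequences. *)
Definition it_map (n r : nat) (A : itransducer n r) (q : A)
    (x y : nat -> letter n r) : Prop :=
  lam_omega (@itpi n r A) (@itlam n r A) x q y.

Definition represents (n r : nat) (A : itransducer n r)
    (h : Cnr n r -> Cnr n r) : Prop :=
  forall x, it_map (it0 A) (Cnr_seq x) (Cnr_seq (h x)).

Definition it_finite (n r : nat) (A : itransducer n r) : Prop :=
  finite_set [set: A].

Definition it_minimal (n r : nat) (A : itransducer n r) : Prop :=
  [/\ forall q : A, exists nu,
        it_reads nu (it0 A) /\ it_pi_word nu (it0 A) = q,
      forall nu, nu <> [::] -> it_reads nu (it0 A) ->
        is_lcp (it_lam_word nu (it0 A))
          [set y | exists2 x, cone nu x & it_map (it0 A) (Cnr_seq x) y]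
    & forall p q : A, p <> it0 A -> q <> it0 A ->
        (forall (x : nat -> 'I_n) (y : nat -> letter n r),
           it_map p (undotted r x) y <-> it_map q (undotted r x) y) ->
        p = q].

(* pi(w, q) = s for all states q from which w can be read *)
Definition sync_value (n r : nat) (A : itransducer n r)
    (w : seq (letter n r)) (s : A) : Prop :=
  forall q : A, it_reads w q -> it_pi_word w q = s.

Definition sync_at (n r : nat) (A : itransducer n r) (m : nat) : Prop :=
  forall w : seq (letter n r), size w = m -> exists s : A, sync_value w s.

Definition strongly_synchronizing (n r : nat) (A : itransducer n r) : Prop :=
  exists m, sync_at A m.

Definition core_states (n r : nat) (A : itransducer n r) (m : nat) : set A :=
  [set s | exists w : seq 'I_n, size w = m /\ sync_value (map inr w) s].

Arguments core_states {n r} A m _.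

Definition Bnr (n r : nat) : set (Cnr n r -> Cnr n r) :=
  [set h | exists k : Cnr n r -> Cnr n r,
    [/\ cancel h k /\ cancel k h,
        continuous h /\ continuous k,
        exists A : itransducer n r,
          [/\ it_finite A, strongly_synchronizing A & represents A h]
      & exists A : itransducer n r,
          [/\ it_finite A, strongly_synchronizing A & represents A k]]].

(* A core has at most #|X_n^m| states, so up to strong isomorphism only
   transducers with state set 'I_k are needed. Letting the state set range over
   all types would put the classes below above the universe of [set]. *)
Record transducer (n : nat) := Transducer {
  tsize : nat;
  tpi : 'I_n -> 'I_tsize -> 'I_tsize;
  tlam : 'I_n -> 'I_tsize -> seq 'I_n;
  t_infinite : forall q (x : nat -> 'I_n),
    exists y : nat -> 'I_n, lam_omega tpi tlam x q y
}.

Definition tstate (n : nat) (T : transducer n) := 'I_(tsize T).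

Definition strongly_isomorphic (n : nat) (T1 T2 : transducer n) : Prop :=
  exists f : tstate T1 -> tstate T2,
    [/\ bijective f,
        forall x q, f (tpi x q) = tpi x (f q)
      & forall x q, tlam x (f q) = tlam x q].

Definition iso_class (n : nat) (T : transducer n) : set (transducer n) :=
  [set T' | strongly_isomorphic T T'].

(* T is, up to strong isomorphism, the restriction of A to its core states;
   [f] embeds the states of T onto them. *)
Definition is_core (n r : nat) (A : itransducer n r) (T : transducer n) : Prop :=
  exists2 m, sync_at A m & exists f : tstate T -> A,
    [/\ injective f,
        range f = core_states A m,
        forall x q, f (tpi x q) = itpi (inr x) (f q)
      & forall x q, itlam (inr x) (f q) = map inr (tlam x q)].

(* Elements are strong isomorphism classes of transducers over X_n, namely
   those of the cores Core(A_g) of the minimal transducers A_g for g in B_{n,r}. *)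
Definition Onr (n r : nat) : set (set (transducer n)) :=
  [set C | exists (g : Cnr n r -> Cnr n r) (A : itransducer n r) (T : transducer n),
    [/\ Bnr g, represents A g, it_minimal A, is_core A T & C = iso_class T]].

Arguments Onr n r _ : clear implicits.

Definition On (n : nat) : set (set (transducer n)) :=
  \bigcup_(r in [set r : nat | (1 <= r < n)%N]) Onr n r.

Arguments On n _ : clear implicits.

(* Main.v *)
(* Fix a letter z and write a sequence over X_n as z^{a_0} y_0 z^{a_1} y_1 ...
   with y_i <> z. Exchanging the values k and k + 1 among the a_i is an involution
   of C_n, computed with delay at most one by a transducer that only remembers
   the number, capped at k + 2, of letters z read since the last other letter;
   after k + 2 letters this number no longer depends on the initial state.
   Applied after the dotted letter it gives an element of B_{n,r} whose core has
   exactly k + 3 states, so the cores for different k are not isomorphic. *)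
Require Import Defs.
From mathcomp Require Import all_boot all_classical.
From mathcomp Require Import topology.
From mathcomp Require Import zify.

Set Implicit Arguments.
Unset Strict Implicit.
Unset Printing Implicit Defensive.

Local Open Scope classical_set_scope.

(** * Words, prefixes and infinite outputs of machines *)

Section Words.
Variables X Y Q : Type.
Variables (pi : X -> Q -> Q) (lam : X -> Q -> seq Y).

Lemma pi_word_cat u v q :
  pi_word pi (u ++ v) q = pi_word pi v (pi_word pi u q).
Proof. by elim: u q => //= x u IH q; rewrite IH. Qed.

Lemma lam_word_cat u v q :
  lam_word pi lam (u ++ v) q =
  lam_word pi lam u q ++ lam_word pi lam v (pi_word pi u q).
Proof. by elim: u q => //= x u IH q; rewrite IH catA. Qed.

Lemma lam_omega_prefix x q y w :
  lam_omega pi lam x q y -> seq_prefix w x -> seq_prefix (lam_word pi lam w q) y.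
Proof. by move=> [py _] ->; apply: py. Qed.

End Words.

Section SeqPrefix.
Variable Y : Type.
Implicit Types (u v w : seq Y) (y : nat -> Y).

Lemma seq_prefixP w y :
  seq_prefix w y <-> (forall (y0 : Y) i, (i < size w)%N -> nth y0 w i = y i).
Proof.
split=> [wy y0 i iw|]; first by rewrite wy nth_mkseq.
case: w => [//|a w] wy; apply: (@eq_from_nth _ a).
  by rewrite size_mkseq.
by move=> i iw; rewrite nth_mkseq // wy.
Qed.

Lemma seq_prefix_catl u v y : seq_prefix (u ++ v) y -> seq_prefix u y.
Proof.
move=> /seq_prefixP uvy; apply/seq_prefixP => y0 i iu.
by rewrite -(uvy y0) ?nth_cat ?iu // size_cat ltn_addr.
Qed.

Lemma seq_prefix_mkseq y j : seq_prefix (mkseq y j) y.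
Proof. by rewrite /seq_prefix size_mkseq. Qed.

Lemma mkseqD y i j :
  mkseq y (i + j) = mkseq y i ++ mkseq (fun l => y (i + l)%N) j.
Proof.
by rewrite /mkseq iotaD map_cat add0n -{2}[i]addn0 iotaDl -map_comp.
Qed.

Lemma seq_prefix_eq (y0 : Y) u v y :
  seq_prefix u y -> seq_prefix v y -> (size u <= size v)%N -> u = take (size u) v.
Proof.
move=> -> -> ; rewrite !size_mkseq => /subnKC<-.
by rewrite mkseqD take_size_cat ?size_mkseq.
Qed.

End SeqPrefix.

(** A common prefix [v] longer than [u] would carry both [a] and [b] at position [size u]. This
    settles the longest common prefix condition of minimality. *)
Lemma seq_prefix_diverge (Y : eqType) (u v s t : seq Y) (a b : Y) (f g : nat -> Y) :
  a != b -> seq_prefix (u ++ a :: s) f -> seq_prefix (u ++ b :: t) g ->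
  seq_prefix v f -> seq_prefix v g -> prefix v u.
Proof.
move=> ab uf ug vf vg; have [vu|uv] := leqP (size v) (size u).
  have -> : v = take (size v) u.
    rewrite {1}(seq_prefix_eq a vf uf) ?take_cat; last by rewrite size_cat; lia.
    have [//|uv] := ltnP (size v) (size u).
    have -> : size v = size u by apply/eqP; rewrite eqn_leq vu uv.
    by rewrite subnn take0 take_size cats0.
  exact: prefix_take.
have at_u c r h : seq_prefix (u ++ c :: r) h -> h (size u) = c.
  move=> /seq_prefixP/(_ c (size u)).
  by rewrite size_cat nth_cat ltnn subnn /= addnS ltnS leq_addr => ->.
move/seq_prefixP: vf => /(_ a _ uv); move/seq_prefixP: vg => /(_ a _ uv) ->.
by rewrite (at_u _ _ _ uf) (at_u _ _ _ ug) => ba; rewrite ba eqxx in ab.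
Qed.

Lemma seq_prefix_nth (Y : Type) (y0 : Y) (w : seq Y) : seq_prefix w (nth y0 w).
Proof. by rewrite /seq_prefix mkseq_nth. Qed.

Lemma seq_prefix_map (X Y : Type) (f : X -> Y) (w : seq X) (x : nat -> X) :
  seq_prefix w x -> seq_prefix (map f w) (f \o x).
Proof. by move=> wx; rewrite /seq_prefix size_map {1}wx /mkseq -map_comp. Qed.

(** Outputs on longer prefixes extend those on shorter ones, so the letter at position [l] can be
    read off any output longer than [l]. *)
Lemma lam_omega_exists (X Y Q : Type) (pi : X -> Q -> Q) (lam : X -> Q -> seq Y)
    (x : nat -> X) q (y0 : Y) :
  (forall N, exists k, (N <= size (lam_word pi lam (mkseq x k) q))%N) ->
  exists y, lam_omega pi lam x q y.
Proof.
move=> grow; pose out j := lam_word pi lam (mkseq x j) q.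
have stable i j l : (l < size (out i))%N -> (l < size (out j))%N ->
    nth y0 (out i) l = nth y0 (out j) l.
  wlog ij : i j / (i <= j)%N.
    by move=> H li lj; case/orP: (leq_total i j) => /H -> //.
  rewrite -(subnKC ij) /out mkseqD lam_word_cat => li _.
  by rewrite nth_cat li.
have /choice[m mP] := grow.
exists (fun l => nth y0 (out (m l.+1)) l); split=> // j.
apply/seq_prefixP => y1 l lj; rewrite (set_nth_default y0) //.
by apply: stable => //; exact: mP.
Qed.

(** * The run-exchanging machine on integer states *)

(* The state is the number of letters z read in the current run, capped at
   k + 2. In state k + 1 only z^k has been written, since the run may end there
   and a run of length k + 1 becomes z^k. *)
Section RunSwap.
Variables (n : nat) (z : 'I_n) (k : nat).

Definition rs_pi (x : 'I_n) (i : nat) : nat :=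
  if x == z then minn i.+1 k.+2 else 0.

Definition rs_lam (x : 'I_n) (i : nat) : seq 'I_n :=
  if x == z then (if i == k then [::] else if i == k.+1 then [:: z; z] else [:: z])
  else (if i == k then [:: z; x] else [:: x]).

Lemma rs_pi_lt x i : (rs_pi x i < k.+3)%N.
Proof. by rewrite /rs_pi; case: ifP => // _; rewrite ltnS geq_minr. Qed.

(** The slack of 1 pays for the only silent step, from state k to k + 1. There the slack is 0, and
    the next letter read writes at least one letter, which counts twice. *)
Lemma rs_size_lam w i :
  (size w <= (size (lam_word rs_pi rs_lam w i)).*2 + (i != k.+1))%N.
Proof.
elim: w i => //= x w IH i; rewrite size_cat.
have := IH (rs_pi x i); rewrite /rs_lam /rs_pi.
by case: (x == z); (repeat case: ifP) => /=; lia.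
Qed.

(* If the machine in state k + 1 has read z^{k+1} and written z^k, then a second
   copy fed with its output is in state k and still owes one letter z. *)
Lemma rs_involutive w i : (i < k.+3)%N ->
  lam_word rs_pi rs_lam (lam_word rs_pi rs_lam w i) (if i == k.+1 then k else i)
    ++ nseq (pi_word rs_pi w i == k.+1) z = nseq (i == k.+1) z ++ w.
Proof.
elim: w i => [|x w IH] i ik /=; first by rewrite cats0.
(* The claim for the single letter [x]: [e1] compares the words, and [e2] says that the second copy
   ends in the state matching [rs_pi x i], so that the induction can continue. *)
have [e1 e2] : 
    lam_word rs_pi rs_lam (rs_lam x i) (if i == k.+1 then k else i)
      ++ nseq (rs_pi x i == k.+1) z = nseq (i == k.+1) z ++ [:: x] /\
    pi_word rs_pi (rs_lam x i) (if i == k.+1 then k else i) =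
      if rs_pi x i == k.+1 then k else rs_pi x i.
  rewrite /rs_lam; case: (eqVneq x z) => [->|xz].
    have pz j : rs_pi z j = minn j.+1 k.+2 by rewrite /rs_pi eqxx.
    have [->|nik] := eqVneq i k.
      by rewrite pz (minn_idPl _) // eqxx (ltn_eqF (ltnSn k)) /=.
    have [->|nik1] := eqVneq i k.+1.
      rewrite pz minnn (gtn_eqF (ltnSn _)) /= !pz !(minn_idPl _) //= .
      by rewrite /rs_lam !eqxx (gtn_eqF (ltnSn _)).
    rewrite /= /rs_lam eqxx (negbTE nik) (negbTE nik1) pz.
    by have -> : (minn i.+1 k.+2 == k.+1) = false by lia.
  have px j : rs_pi x j = 0 by rewrite /rs_pi (negbTE xz).
  have [->|nik] := eqVneq i k.
    rewrite px (ltn_eqF (ltnSn k)) /= px /rs_lam eqxx (negbTE xz) /=.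
    by rewrite /rs_pi eqxx (minn_idPl _) // eqxx (gtn_eqF (ltnSn k)).
  have [->|nik1] := eqVneq i k.+1.
    by rewrite /= px /rs_lam (negbTE xz) eqxx.
  by rewrite /= px /rs_lam (negbTE xz) (negbTE nik).
rewrite lam_word_cat e2 -catA IH ?rs_pi_lt // catA e1.
by rewrite -catA.
Qed.

Lemma rs_pi_nseq i j : (i < k.+3)%N ->
  pi_word rs_pi (nseq j z) i = minn (i + j) k.+2.
Proof.
elim: j i => [|j IH] i ik /=; first by lia.
by rewrite IH ?rs_pi_lt // /rs_pi eqxx; lia.
Qed.

Definition swap_run (a : nat) : nat :=
  if a == k then k.+1 else if a == k.+1 then k else a.

(** The whole run is to become [swap_run (i + j)] letters [z], and in state [i] the subtracted
    number of them is already written. In the capped state k + 2 the true run may be longer, but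
    there [swap_run] is the identity and the difference is [j] anyway. *)
Lemma rs_lam_run (y : 'I_n) i j : y != z -> (i < k.+3)%N ->
  lam_word rs_pi rs_lam (rcons (nseq j z) y) i =
  rcons (nseq (swap_run (i + j) - (if i == k.+1 then k else i)) z) y.
Proof.
move=> yz; elim: j i => [|j IH] i ik.
  rewrite /= /rs_lam (negbTE yz) addn0 /swap_run cats0.
  case: (eqVneq i k) => [->|nik]; first by rewrite ltn_eqF // subSnn.
  by case: ifP => _; rewrite subnn.
rewrite /= IH ?rs_pi_lt // /rs_lam /rs_pi eqxx /swap_run.
have nz m : z :: rcons (nseq m z) y = rcons (nseq m.+1 z) y by [].
case: ifP => [/eqP e|ne]; last case: ifP => [/eqP e|ne1]; rewrite /= ?nz;
  congr (rcons (nseq _ _) _); repeat case: ifP; lia.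
Qed.

Lemma swap_run_inj_state i j : (i < k.+3)%N -> (j < k.+3)%N ->
  (forall m, swap_run (i + m) - (if i == k.+1 then k else i) =
             swap_run (j + m) - (if j == k.+1 then k else j)) -> i = j.
Proof.
wlog ij : i j / (i < j)%N.
  move=> H ik jk e; case: (ltngtP i j) => // [ij|ji]; first exact: (H i j).
  by apply/esym/(H j i) => // m; rewrite e.
move=> ik jk e.
(* Test lengths for i < j. If j <= k, [e1] completes a run of length k from [j] only, which adds a
   letter. If i <= k < j, passing from length k - i to k + 1 - i lowers the count from [i] but
   raises that from [j]. For k + 1 and k + 2, one letter gives 2 against 1. *)
have e1 := e (k - j); have e2 := e (k.+1 - i); have e3 := e (k - i); have e4 := e 1.
move: {e} e1 e2 e3 e4; rewrite /swap_run.
have [jk0|jk0] := leqP j k.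
  move=> + _ _ _; repeat case: ifP; lia.
have [ik0|ik0] := leqP i k.
  move=> _ + + _; repeat case: ifP; lia.
move=> _ _ _; repeat case: ifP; lia.
Qed.

(** From every state the next written letter can still be [z] or [y]; hence the machine never
    withholds output that is already determined. *)
Lemma rs_branch y i : y != z -> exists w1 s1 w2 s2,
  lam_word rs_pi rs_lam w1 i = z :: s1 /\ lam_word rs_pi rs_lam w2 i = y :: s2.
Proof.
move=> yz; have [->|nik] := eqVneq i k.
  (* In state k, reading [y] releases an additional [z] first, whereas [z; y] makes a run of length
     k + 1, whose image z^k is already written. *)
  exists [:: y], [:: y], [:: z; y], [::].
  rewrite /= /rs_lam /rs_pi !eqxx (negbTE yz) (minn_idPl _) //.
  by rewrite (gtn_eqF (ltnSn k)).
exists [:: z], (if i == k.+1 then [:: z] else [::]), [:: y], [::].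
rewrite /= /rs_lam !eqxx (negbTE yz) (negbTE nik).
by case: ifP.
Qed.

Lemma rs_pi_nseq_reset y i j : y != z -> pi_word rs_pi (nseq j.+1 y) i = 0.
Proof.
move=> yz; elim: j i => [|j IH] i; last exact: IH.
by rewrite /= /rs_pi (negbTE yz).
Qed.

End RunSwap.

(** * Continuity of maps determined by finite prefixes *)

Lemma nbhs_Cn_mkseq n (x : Cn n) N :
  nbhs x [set x' : Cn n | mkseq x' N = mkseq x N].
Proof.
elim: N => [|N IH]; first by apply: filterE.
have xN : nbhs x [set x' : Cn n | x' N = x N].
  have xN1 : nbhs (x N : discrete_topology 'I_n) [set x N] by exact: discrete_set1.
  exact: (@proj_continuous nat (fun=> discrete_topology 'I_n) N x _ xN1).
by near=> x'; rewrite /= !mkseqS; congr rcons; near: x'.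
Unshelve. all: by end_near. Qed.

(** Convergence in the product is coordinatewise, and in a discrete factor local constancy
    suffices. *)
Lemma Cn_continuous n (h : Cn n -> Cn n) :
  (forall x i, exists N, forall x', mkseq x' N = mkseq x N -> h x' i = h x i) ->
  continuous h.
Proof.
move=> loc x; have FF : Filter (h x' @[x' --> x]).
  exact: (@fmap_filter _ _ h _
    (@nbhs_filter (prod_topology (fun _ : nat => discrete_topology 'I_n)) x)).
apply/cvg_sup => i U /= [_ [[B _ <-] Bhx] BU].
have [N hN] := loc x i.
apply: filterS (nbhs_Cn_mkseq x N) => x' /hN hx'.
by apply: BU; rewrite /= hx'.
Qed.

Lemma Cnr_continuous n r (h : Cn n -> Cn n) : continuous h ->
  continuous (fun p : Cnr n r => (p.1, h p.2) : Cnr n r).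
Proof.
move=> ch p.
have snd_h : (h q.2) @[q --> p] --> h p.2.
  exact: (@continuous_comp _ _ _ (@snd _ _) h p (@cvg_snd _ _ _ _ _) (ch p.2)).
apply: (cvg_pair (@cvg_fst _ _ _ _ _) snd_h).
Qed.

(** * The transducer over X_n and its involutive homeomorphism *)

Section RunSwapTransducer.
Variables (n : nat) (z : 'I_n) (k : nat).

Definition rs_tpi (x : 'I_n) (q : 'I_k.+3) : 'I_k.+3 := Ordinal (rs_pi_lt z k x q).

Definition rs_tlam (x : 'I_n) (q : 'I_k.+3) : seq 'I_n := rs_lam z k x q.

Lemma val_rs_tpi_word w q :
  val (pi_word rs_tpi w q) = pi_word (rs_pi z k) w q.
Proof. by elim: w q => //= x w IH q; rewrite IH. Qed.

Lemma rs_tlam_word w q :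
  lam_word rs_tpi rs_tlam w q = lam_word (rs_pi z k) (rs_lam z k) w q.
Proof. by elim: w q => //= x w IH q; rewrite IH. Qed.

Lemma rs_size_tlam w q : (size w <= (size (lam_word rs_tpi rs_tlam w q)).*2.+1)%N.
Proof.
rewrite rs_tlam_word; apply: leq_trans (rs_size_lam z k w q) _.
by case: (_ != _); rewrite ?addn1 ?addn0.
Qed.

Lemma rs_infinite q (x : nat -> 'I_n) :
  exists y : nat -> 'I_n, lam_omega rs_tpi rs_tlam x q y.
Proof.
apply: lam_omega_exists => // N; exists N.*2.+1.
by have := rs_size_tlam (mkseq x N.*2.+1) q; rewrite size_mkseq; lia.
Qed.

Definition rs_transducer : transducer n := Transducer rs_infinite.

(** The choice is harmless: outputs of unbounded length determine the sequence. *)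
Definition rs_map (x : Cn n) : Cn n := sval (cid (rs_infinite ord0 x)).

Lemma rs_mapP x : lam_omega rs_tpi rs_tlam x ord0 (rs_map x).
Proof. exact: svalP (cid (rs_infinite ord0 x)). Qed.

Lemma rs_mapK : involutive rs_map.
Proof.
move=> x; apply: funext => i.
(* By [rs_involutive], two passes return [w] except for at most one final [z], so position [i] lies
   inside [v]. *)
pose w := mkseq x i.+2.*2.
pose u := lam_word rs_tpi rs_tlam w ord0; pose v := lam_word rs_tpi rs_tlam u ord0.
have vw : v ++ nseq (pi_word (rs_pi z k) w 0 == k.+1) z = w.
  by have := rs_involutive z w (ltn0Sn k.+2); rewrite /= /v /u !rs_tlam_word.
have uP : seq_prefix u (rs_map x) by exact: (rs_mapP x).1.
have /seq_prefixP vP : seq_prefix v (rs_map (rs_map x)).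
  exact: lam_omega_prefix (rs_mapP _) uP.
have szw : size w = i.+2.*2 by rewrite size_mkseq.
have iv : (i < size v)%N.
  by have := congr1 size vw; rewrite size_cat size_nseq szw; case: (_ == _); lia.
rewrite -(vP z i iv).
have /seq_prefixP/(_ z i) <- := seq_prefix_mkseq x i.+2.*2.
  by rewrite -/w -vw nth_cat iv.
by rewrite -/w szw; lia.
Qed.

Lemma rs_map_continuous : continuous rs_map.
Proof.
(* By [rs_size_tlam], 2(i + 1) input letters force at least i + 1 output letters, which include
   position [i]. *)
apply: Cn_continuous => x i; exists i.+1.*2 => x' xx'.
pose w := mkseq x i.+1.*2.
have iw : (i < size (lam_word rs_tpi rs_tlam w ord0))%N.
  by have := rs_size_tlam w ord0; rewrite size_mkseq; lia.
have /seq_prefixP/(_ z i iw) <- := (rs_mapP x).1 i.+1.*2.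
by have /seq_prefixP := (rs_mapP x').1 i.+1.*2; rewrite xx' => /(_ z i iw) ->.
Qed.

Definition rs_homeo r (p : Cnr n r) : Cnr n r := (p.1, rs_map p.2).

Lemma rs_homeoK r : involutive (@rs_homeo r).
Proof. by case=> c x; rewrite /rs_homeo /= rs_mapK. Qed.

Lemma rs_homeo_continuous r : continuous (@rs_homeo r).
Proof. exact: Cnr_continuous rs_map_continuous. Qed.

(** * The transducer with initial state representing the homeomorphism *)

Section Initial.
Variable r : nat.

(* [None] is the initial state q_0, and R = {q_0}. The value of [rs_ipi] at a
   letter of X_n and [None] is junk. *)
Definition rs_ipi (x : letter n r) (q : option 'I_k.+3) : option 'I_k.+3 :=
  Some (if x is inr a then rs_tpi a (odflt ord0 q) else ord0).

Definition rs_ilam (x : letter n r) (q : option 'I_k.+3) : seq (letter n r) :=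
  if x is inr a then map inr (rs_tlam a (odflt ord0 q)) else [:: x].

Lemma rs_ipi_word v (q : 'I_k.+3) :
  pi_word rs_ipi (map inr v) (Some q) = Some (pi_word rs_tpi v q).
Proof. by elim: v q => //= x v IH q; rewrite IH. Qed.

Lemma rs_ilam_word v (q : 'I_k.+3) :
  lam_word rs_ipi rs_ilam (map inr v) (Some q) =
  map inr (lam_word rs_tpi rs_tlam v q).
Proof. by elim: v q => //= x v IH q; rewrite IH map_cat. Qed.

Lemma rs_reads_Some w (q : 'I_k.+3) :
  reads_word None rs_ipi w (Some q) -> exists v, w = map inr v.
Proof.
elim: w q => [|[c|a] w IH] q /=; first by exists [::].
  by case.
by case=> _ /IH[v ->]; exists (a :: v).
Qed.

Lemma rs_reads_None w : w <> [::] -> reads_word None rs_ipi w None ->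
  exists c v, w = inl c :: map inr v.
Proof.
case: w => // -[c|a] w _ /= []// _ /rs_reads_Some[v ->].
by exists c, v.
Qed.

Lemma rs_R_finite : finite_set [set None : option 'I_k.+3].
Proof. exact: finite_set1. Qed.

Lemma rs_S_countable : countable (~` [set None : option 'I_k.+3]).
Proof. exact: countableP. Qed.

Lemma rs_ipi_not0 x q : reads None x q -> rs_ipi x q <> None.
Proof. by []. Qed.

Lemma rs_toR x q : reads None x q -> [set None] (rs_ipi x q) ->
  [set None] q /\ rs_ilam x q = [::].
Proof. by []. Qed.

Lemma rs_RtoS x q : reads None x q -> [set None] q -> ~ [set None] (rs_ipi x q) ->
  is_Wnr_word (rs_ilam x q).
Proof. by case: x => [c|a /[swap] ->] // _ _ _; exists c, [::]. Qed.

Lemma rs_S x q : reads None x q -> ~ [set None] q ->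
  ~ [set None] (rs_ipi x q) /\ is_Xn_word (rs_ilam x q).
Proof.
case: x => [c -> /(_ erefl)//|a _ _]; split=> //.
by exists (rs_tlam a (odflt ord0 q)).
Qed.

(** By the length bound a silent word has at most one letter, and the only silent step changes k
    into k + 1. No loop meets [None], as all transitions end in [Some]. *)
Lemma rs_cycle w q : reads_word None rs_ipi w q -> w <> [::] ->
  pi_word rs_ipi w q = q -> lam_word rs_ipi rs_ilam w q <> [::].
Proof.
case: q => [q|] wq w0; last first.
  by have [c [v ->]] := rs_reads_None w0 wq; rewrite /= rs_ipi_word.
have [v vE] := rs_reads_Some wq; rewrite vE rs_ipi_word rs_ilam_word in w0 *.
move=> [/(congr1 val)]; rewrite val_rs_tpi_word.
move=> vq /(congr1 size); rewrite size_map => /size0nil lam0.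
have := rs_size_tlam v q; rewrite lam0; case: v w0 vq lam0 {vE} => [|x []] //= _.
rewrite cats0 /rs_tlam /rs_pi /rs_lam; move: (q : nat) => i.
by (repeat case: ifP) => //; lia.
Qed.

Lemma lam_omega_Some x y q : lam_omega rs_tpi rs_tlam x q y ->
  lam_omega rs_ipi rs_ilam (undotted r x) (Some q) (undotted r y).
Proof.
move=> [py uy]; have E j : mkseq (undotted r x) j = map inr (mkseq x j).
  by rewrite /mkseq -map_comp.
split=> j; first by rewrite E rs_ilam_word; exact: seq_prefix_map.
by have [l jl] := uy j; exists l; rewrite E rs_ilam_word size_map.
Qed.

Lemma rs_it_infinite q (x : nat -> 'I_n) : ~ [set None] q ->
  exists y, lam_omega rs_ipi rs_ilam (undotted r x) q (undotted r y).
Proof.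
case: q => [q _|/(_ erefl)//]; have [y xy] := rs_infinite q x.
by exists y; exact: lam_omega_Some.
Qed.

Definition rs_itransducer : itransducer n r :=
  ITransducer rs_R_finite rs_S_countable erefl rs_ipi_not0 rs_toR rs_RtoS rs_S
    rs_cycle rs_it_infinite.

Lemma mkseq_Cnr_seq (p : Cnr n r) j :
  mkseq (Cnr_seq p) j.+1 = inl p.1 :: map inr (mkseq p.2 j).
Proof. by rewrite -add1n mkseqD /= /mkseq -map_comp. Qed.

Lemma rs_represents : represents rs_itransducer (@rs_homeo r).
Proof.
case=> c x; split=> /= [[//|j]|N].
  rewrite mkseq_Cnr_seq /= rs_ilam_word.
  have := (rs_mapP x).1 j; rewrite /seq_prefix /= size_map => {1}->.
  by rewrite mkseq_Cnr_seq.
have [j Nj] := (rs_mapP x).2 N; exists j.+1.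
by rewrite mkseq_Cnr_seq /= rs_ilam_word size_map; apply: leqW.
Qed.

(** * Synchronization, core, minimality and membership in [Onr] *)

Lemma rs_reads_map v (q : 'I_k.+3) : reads_word None rs_ipi (map inr v) (Some q).
Proof. by elim: v q => //= x v IH q; split=> //; exact: IH. Qed.

(** Every letter other than [z], dotted or not, leads to state 0 from everywhere. *)
Lemma rs_ipi_reset w :
  has (fun x : letter n r => if x is inr a then a != z else true) w ->
  forall p q, pi_word rs_ipi w p = pi_word rs_ipi w q.
Proof.
elim: w => //= x w IH /orP[xr|wr] p q; last exact: IH.
congr (pi_word _ _ (Some _)); case: x xr => // a az.
by apply: val_inj; rewrite /= /rs_pi (negbTE az).
Qed.

Lemma rs_sync : sync_at rs_itransducer k.+3.
Proof.
move=> w sz.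
have [wr|] := boolP (has (fun x : letter n r => if x is inr a then a != z else true) w).
  by exists (it_pi_word (A := rs_itransducer) w None) => q _; exact: rs_ipi_reset.
(* The remaining word is z^{k+3}; it drives every state of S to the cap k + 2 and cannot be read
   from [None]. *)
rewrite -all_predC => wz; exists (Some ord_max : rs_itransducer) => q.
have -> : w = map inr (nseq k.+3 z).
  rewrite map_nseq -sz; apply/all_pred1P; apply: sub_all wz => -[//|a] /=.
  by rewrite negbK => /eqP->.
case: q => [q _|[]//]; rewrite /it_pi_word rs_ipi_word; congr Some.
by apply: val_inj; rewrite val_rs_tpi_word rs_pi_nseq //=; lia.
Qed.

Variable y : 'I_n.
Hypothesis yz : y != z.

Lemma rs_core : is_core rs_itransducer rs_transducer.
Proof.
exists k.+3; first exact: rs_sync.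
exists Some; split=> //.
apply/seteqP; split=> [_ [q _ <-]|s [w [_]]].
  (* The letters [y] reset the count and [q] letters [z] raise it to [q]. Since q <= k + 2, length k
     + 3 leaves room for at least one [y]. *)
  exists (nseq (k.+3 - q) y ++ nseq q z); split.
    by rewrite size_cat !size_nseq subnK // ltnW.
  case=> [p _|]; last first.
    rewrite /it_reads; have := ltn_ord q; rewrite -subn_gt0.
    by case: (k.+3 - q) => // m _ [].
  rewrite /it_pi_word rs_ipi_word; congr Some; apply: val_inj.
  rewrite val_rs_tpi_word pi_word_cat.
  have := ltn_ord q; rewrite -subn_gt0; case: (k.+3 - q) => // m _.
  by rewrite rs_pi_nseq_reset // rs_pi_nseq // add0n; apply/minn_idPl; rewrite -ltnS.
move=> /(_ (Some ord0) (rs_reads_map w ord0)).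
by rewrite /it_pi_word rs_ipi_word => <-; eexists.
Qed.

Hypothesis r_gt0 : (0 < r)%N.

Lemma rs_minimal : it_minimal rs_itransducer.
Proof.
split.
- case=> [q|]; last by exists [::].
  exists (inl (Ordinal r_gt0) :: map inr (nseq q z)); split.
    by split=> //; exact: rs_reads_map.
  rewrite /it_pi_word /= rs_ipi_word; congr Some; apply: val_inj.
  by rewrite val_rs_tpi_word rs_pi_nseq // add0n; apply/minn_idPl; rewrite -ltnS.
- move=> nu nu0 /(rs_reads_None nu0)[c [v nuE]]; split.
    by move=> f [x nux xf]; exact: lam_omega_prefix xf nux.
  move=> u uB; pose q := pi_word rs_tpi v ord0.
  have [w1 [s1 [w2 [s2 [e1 e2]]]]] := rs_branch k q yz.
  (* The point [p] continues [nu] by [w], padded with [z]; its image has [u] as a prefix and shows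
     the letter [a] right after the output of [nu]. *)
  have ext a w s : lam_word (rs_pi z k) (rs_lam z k) w q = a :: s ->
      exists2 f, seq_prefix u f &
        seq_prefix (it_lam_word (A := rs_itransducer) nu None ++ inr a :: map inr s) f.
    move=> ws; pose p : Cnr n r := (c, nth z (v ++ w)).
    have pP : seq_prefix (nu ++ map inr w) (Cnr_seq p).
      rewrite nuE /seq_prefix /= -map_cat size_map mkseq_Cnr_seq.
      by rewrite [mkseq _ _](mkseq_nth).
    exists (Cnr_seq (rs_homeo p)).
      apply: uB; exists p; last exact: rs_represents.
      exact: seq_prefix_catl pP.
    have := lam_omega_prefix (rs_represents p) pP.
    rewrite /it_lam_word lam_word_cat nuE /= !rs_ipi_word !rs_ilam_word.
    by rewrite (rs_tlam_word w) ws.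
  have [f1 uf1 wf1] := ext _ _ _ e1; have [f2 uf2 wf2] := ext _ _ _ e2.
  apply: (seq_prefix_diverge _ wf1 wf2 uf1 uf2).
  by apply: contra_neq yz => -[].
- move=> [p|//] [q|//] _ _ pq; congr Some; apply: val_inj.
  apply: (@swap_run_inj_state k) => [| |m]; [exact: ltn_ord..|].
  set a := (X in X = _); set b := (X in _ = X).
  (* On z^m y the two states write z^a y and z^b y. Both are prefixes of the same [f], whose first
     letter other than [z] fixes a = b. *)
  pose w := rcons (nseq m z) y; pose x := nth z w.
  have [f xf] := rs_infinite p x.
  have fp := lam_omega_Some xf; have fq := (pq _ _).1 fp.
  have wx : seq_prefix (map inr w) (undotted r x).
    exact: seq_prefix_map (seq_prefix_nth z w).
  have := lam_omega_prefix fp wx; have := lam_omega_prefix fq wx.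
  rewrite !rs_ilam_word !rs_tlam_word /w !rs_lam_run // -/a -/b.
  have cmp (i j : nat) : (i < j)%N ->
      seq_prefix (map inr (rcons (nseq i z) y)) (undotted r f) ->
      seq_prefix (map inr (rcons (nseq j z) y)) (undotted r f) -> False.
    move=> ij /seq_prefixP/(_ (inr z) i) + /seq_prefixP/(_ (inr z) i).
    rewrite !size_map !size_rcons !size_nseq ltnSn ltnS (ltnW ij).
    rewrite !(nth_map z) ?size_rcons ?size_nseq ?ltnS ?(ltnW ij) //.
    rewrite !nth_rcons !size_nseq ltnn eqxx ij nth_nseq ij => <- // /(_ isT) [zy].
    by move: yz; rewrite zy eqxx.
  move=> bP aP; case: (ltngtP a b) => // [ab|ba].
    by case: (cmp _ _ ab aP bP).
  by case: (cmp _ _ ba bP aP).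
Qed.

(** The homeomorphism is its own inverse, so one transducer serves for both directions. *)
Lemma rs_Bnr : Bnr (@rs_homeo r).
Proof.
exists (@rs_homeo r).
have repr : exists A : itransducer n r,
    [/\ it_finite A, strongly_synchronizing A & represents A (@rs_homeo r)].
  exists rs_itransducer; split; last exact: rs_represents.
    exact: (@finite_finset (option 'I_k.+3)).
  by exists k.+3; exact: rs_sync.
by split=> //; split; do ?exact: rs_homeoK; exact: rs_homeo_continuous.
Qed.

Lemma rs_Onr : Onr n r (iso_class rs_transducer).
Proof.
exists (@rs_homeo r), rs_itransducer, rs_transducer; split=> //.
- exact: rs_Bnr.
- exact: rs_represents.
- exact: rs_minimal.
- exact: rs_core.
Qed.

End Initial.
End RunSwapTransducer.

(** * Infinitely many classes, told apart by their number of states *)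

Lemma iso_class_tsize n (T1 T2 : transducer n) :
  iso_class T1 = iso_class T2 -> Defs.tsize T1 = Defs.tsize T2.
Proof.
move=> e; have : iso_class T1 T2 by rewrite e; exists id; split=> //; exists id.
by case=> f [/bij_eq_card]; rewrite !card_ord.
Qed.

Lemma Onr_infinite n r : (1 < n)%N -> (0 < r)%N -> infinite_set (Onr n r).
Proof.
move=> n1 r0 fin; apply: infinite_nat.
pose z : 'I_n := Ordinal (ltnW n1); pose y : 'I_n := Ordinal n1.
(* The map from k to its class is injective, having k + 3 states, so a finite [Onr n r] would make
   its preimage, all of [nat], finite. *)
rewrite (_ : setT = (fun k => iso_class (rs_transducer z k)) @^-1` Onr n r).
  by apply: finite_preimage fin => i j _ _ /iso_class_tsize[].
by apply/seteqP; split=> // k _; exact: (@rs_Onr _ z k r y).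
Qed.

Theorem theorem1p3 (n : nat) (n_ge2 : (2 <= n)%N) :
  (forall r : nat, (1 <= r < n)%N -> infinite_set (Onr n r)) /\
  infinite_set (On n).
Proof.
split=> [r /andP[r0 _]|]; first exact: Onr_infinite.
(* The index r = 1 is admissible exactly because n >= 2. *)
apply: (@sub_infinite_set _ (Onr n 1)); last exact: Onr_infinite.
exact: (@bigcup_sup _ _ 1).
Qed.
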